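(* Let $f$ be a sublinear function of $n$. Any deterministic or randomized algorithm that, given the vertex set of an unknown connected unweighted $n$-vertex graph and access to its distance oracle, computes an $f$-approximation of the graph metric requires $\Omega(n^2/f)$ queries.
   Context: Query model: the vertex set $V$ is given and the shortest-path metric $\delta$ is accessible only via an oracle returning $\delta(u,v)$ for a queried pair; cost is the number of queries (for randomized algorithms, the expected number). A function $\widehat{\delta}$ is an $f$-approximation of $\delta$ if $\widehat{\delta}(u,v)\leq\delta(u,v)\leq f\cdot\widehat{\delta}(u,v)$ for every pair $(u,v)$. *)

(* Defs.v *)
From HB Require Import structures.
From mathcomp Require Import all_boot all_order all_algebra.
From mathcomp Require Import all_classical all_reals all_analysis.

Set Implicit Arguments.
Unset Strict Implicit.
Unset Printing Implicit Defensive.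

Import Order.TTheory GRing.Theory Num.Theory.
Import numFieldNormedType.Exports.
Local Open Scope ring_scope.

Record connected_graph (n : nat) := ConnectedGraph {
  adj :> rel 'I_n;
  adj_sym : symmetric adj;
  adj_irrefl : irreflexive adj;
  adj_connected : forall u v, connect adj u v }.

(* [walk G u v k]: some walk from u to v has exactly k edges; the tuple lists
   the vertices after the starting point u. *)
Definition walk (n : nat) (G : connected_graph n) (u v : 'I_n) : pred nat :=
  fun k => [exists p : k.-tuple 'I_n, path G u p && (last u p == v)].

Lemma walk_exists (n : nat) (G : connected_graph n) (u v : 'I_n) :
  exists k, walk G u v k.
Proof.
have /connectP[p Gp ->] := adj_connected G u v.
by exists (size p); apply/existsP; exists (in_tuple p); rewrite Gp eqxx.
Qed.

Definition dist (n : nat) (G : connected_graph n) (u v : 'I_n) : nat :=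
  ex_minn (walk_exists G u v).

Definition approximates (R : realType) (n : nat) (f : R)
    (delta : 'I_n -> 'I_n -> nat) (h : 'I_n -> 'I_n -> R) : Prop :=
  forall u v, h u v <= (delta u v)%:R /\ (delta u v)%:R <= f * h u v.

(* A deterministic query algorithm on a known vertex set is an adaptive decision
   tree: it outputs an estimate of the metric, or queries a pair and continues
   according to the oracle's answer. *)
Inductive algorithm (R : realType) (n : nat) : Type :=
| Output of 'I_n -> 'I_n -> R
| Query of 'I_n & 'I_n & (nat -> algorithm R n).

Fixpoint result (R : realType) (n : nat) (A : algorithm R n)
    (delta : 'I_n -> 'I_n -> nat) : 'I_n -> 'I_n -> R :=
  match A with
  | Output h => h
  | Query u v next => result (next (delta u v)) delta
  end.

Fixpoint num_queries (R : realType) (n : nat) (A : algorithm R n)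
    (delta : 'I_n -> 'I_n -> nat) : nat :=
  match A with
  | Output _ => 0%N
  | Query u v next => (num_queries (next (delta u v)) delta).+1
  end.

Definition computes_approximation (R : realType) (n : nat) (f : R)
    (A : algorithm R n) : Prop :=
  forall G : connected_graph n, approximates f (dist G) (result A (dist G)).

(* A randomized algorithm draws its random seed w in a probability space and
   then runs the decision tree [tree w]; the number of queries made on each
   input is required to be a random variable. *)
Record randomized_algorithm (R : realType) (n : nat) (d : measure_display)
    (T : measurableType d) (P : probability T R) := RandomizedAlgorithm {
  tree :> T -> algorithm R n;
  measurable_num_queries : forall G : connected_graph n,
    measurable_fun setT (fun w => (num_queries (tree w) (dist G))%:R : R) }.

Definition randomized_computes_approximation (R : realType) (n : nat) (f : R)
    (d : measure_display) (T : measurableType d) (P : probability T R)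
    (A : randomized_algorithm n P) : Prop :=
  forall G : connected_graph n,
    {ae P, forall w, approximates f (dist G) (result (A w) (dist G))}.

Definition expected_queries (R : realType) (n : nat)
    (d : measure_display) (T : measurableType d) (P : probability T R)
    (A : randomized_algorithm n P) (G : connected_graph n) : \bar R :=
  ('E_P[fun w => (num_queries (A w) (dist G))%:R])%E.

(* Main.v *)
Require Import Defs.
From HB Require Import structures.
From mathcomp Require Import all_boot all_order all_algebra.
From mathcomp Require Import all_classical all_reals all_analysis.
From mathcomp Require Import measurable_realfun zify lra.
Import Order.TTheory GRing.Theory Num.Theory.
Import numFieldNormedType.Exports.
Local Open Scope classical_set_scope.
Local Open Scope ring_scope.

                                                                                 
                                                                              
                                                                                
                                                                                
                                                                                 
                                                                                 
                                                                                    
                                                                                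
                                                                                
                                                                                 
                                                     

(** The hard inputs are spiders: a centre carrying [m] legs of length [L], with [L] just above [f]
    and [m] about [n / (2 L)], so that about half of the vertices or more stay free. Each free
    vertex becomes a twin of the end of a leg chosen by [s]. If a free [u] moves away from leg [i],
    its distance to the end of leg [i] jumps from 1 to [2 L > f]; no output suits both placements,
    so the algorithm must find the leg of every free vertex.

    With the other vertices fixed, a query at [u] only tells whether [u] lies on one particular leg.
    Elimination therefore costs about [m / 2] queries at [u] on average over its leg
    ([search_lower_bound], [spider_search]). Averaging over all [s] and summing over the free
    vertices, with each query touching at most two of them, gives order [n * m], that is [n^2 / f],
    queries on average ([spider_average], [hard_family]).

    The family does not depend on the algorithm, so averaging over it gives a bad input for
    deterministic algorithms and, after integrating over the seed (Yao's principle), for randomized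
    ones. *)

(** * Realizing a distance function by a graph *)

Lemma graph_of_metric (n : nat) (D : 'I_n -> 'I_n -> nat)
    (D0 : forall x y, (D x y == 0%N) = (x == y))
    (Dsym : forall x y, D x y = D y x)
    (Dlip : forall x y z, D y z = 1%N -> (D x z <= (D x y).+1)%N)
    (Dpred : forall x z, x != z -> exists2 y, D y z = 1%N & D x z = (D x y).+1) :
  exists G : connected_graph n, dist G = D.
Proof.
pose e : rel 'I_n := fun x y => D x y == 1%N.
(* [Dpred] peels off the last edge, so induction on the distance builds a walk of that length. *)
have geodesic k x z : D x z = k ->
    exists p : seq 'I_n, [/\ path e x p, last x p = z & size p = k].
  elim: k x z => [|k IH] x z Dxz.
    by exists [::]; split => //=; apply/eqP; rewrite -D0 Dxz.
  have /Dpred[y Dyz] : x != z by rewrite -D0 Dxz.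
  rewrite Dxz => -[/esym /IH[p [ep lp sp]]].
  exists (rcons p z); split; rewrite ?last_rcons ?size_rcons ?sp //.
  by rewrite rcons_path ep lp /e Dyz /=.
have esym : symmetric e by move=> x y; rewrite /e Dsym.
have eirr : irreflexive e.
  by move=> x; rewrite /e; move: (D0 x x); rewrite eqxx => /eqP ->.
have econn u v : connect e u v.
  have [p [ep lp _]] := geodesic _ u v erefl.
  by apply/connectP; exists p.
exists (ConnectedGraph esym eirr econn).
apply/funext => u; apply/funext => v; rewrite /dist.
case: ex_minnP => k /existsP[p /andP[/= ep /eqP lp]] kmin.
apply/eqP; rewrite eqn_leq; apply/andP; split.
  have [q [eq lq sq]] := geodesic _ u v erefl.
  apply: kmin; apply/existsP; rewrite -sq.
  by exists (in_tuple q); rewrite /= eq lq eqxx.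
(* Conversely, by [Dlip] each edge of a walk raises [D u] by at most one, so no walk is shorter. *)
rewrite -(size_tuple p) -lp.
elim/last_ind: (tval p) ep => [|q z IH] /=; first by rewrite leqn0 D0.
rewrite rcons_path last_rcons size_rcons => /andP[/IH Dq /eqP /(Dlip u) Dz].
exact: leq_trans Dz _.
Qed.

                                                                               
                                                                                
                                                                 
(** * The spider metric *)

(** Vertex 0 is the centre, vertices 1 to [m * L] fill the legs in consecutive blocks of [L], and
    the later vertices are free and sit at the depth of a leg end. *)
Definition depth (L m v : nat) : nat :=
  if v is w.+1 then if (v <= m * L)%N then (w %% L).+1 else L else 0%N.

(** The centre formally falls in leg 0. This is harmless: at depth 0 both distance formulas of
    [spider] agree. *)
Definition leg (L : nat) {m n : nat} (s : {ffun 'I_n -> 'I_m}) (v : 'I_n) : nat :=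
  if (v <= m * L)%N then (v.-1 %/ L)%N else s v.

                                                                                
Definition spider (L : nat) {m n : nat} (s : {ffun 'I_n -> 'I_m}) (x y : 'I_n) : nat :=
  if x == y then 0%N
  else if leg L s x == leg L s y
  then maxn 1 (maxn (depth L m x - depth L m y) (depth L m y - depth L m x))
  else (depth L m x + depth L m y)%N.

Lemma depth_eq0 (L m v : nat) : (0 < L)%N -> (depth L m v == 0%N) = (v == 0%N).
Proof. by case: v => [|v] //= L0; case: ifP => // _; rewrite eqn0Ngt L0. Qed.

Lemma depth_le (L m v : nat) : (0 < L)%N -> (depth L m v <= L)%N.
Proof. by case: v => [|v] //= L0; case: ifP => // _; rewrite ltn_pmod. Qed.

Lemma leg_lt (L m n : nat) (s : {ffun 'I_n -> 'I_m}) (v : 'I_n) :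
  (0 < L)%N -> (0 < m)%N -> (leg L s v < m)%N.
Proof.
move=> L0 m0; rewrite /leg; case: ifP => // vle.
rewrite ltn_divLR //; case: (val v) vle => [|w] //= _; rewrite muln_gt0 m0 //.
Qed.

Lemma leg_vertex (L m n : nat) (s : {ffun 'I_n -> 'I_m}) (i d : nat) :
  (m * L < n)%N -> (i < m)%N -> (0 < d <= L)%N ->
  exists v : 'I_n, [/\ (v <= m * L)%N, leg L s v = i & depth L m v = d].
Proof.
move=> mLn im /andP[d0 dL].
have vle : (i * L + d <= m * L)%N by nia.
exists (Ordinal (leq_ltn_trans vle mLn)); split => //; first rewrite /leg /= vle.
  rewrite -subn1 -addnBA // divnMDl; last by apply: leq_trans dL.
  by rewrite divn_small ?addn0 //; lia.
move: vle; rewrite /depth /=; case: d d0 dL => // d _ dL; rewrite addnS => ->.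
by rewrite modnMDl modn_small.
Qed.

Lemma spider_graph (L m n : nat) (s : {ffun 'I_n -> 'I_m}) :
  (0 < L)%N -> (0 < m)%N -> (m * L < n)%N ->
  exists G : connected_graph n, dist G = spider L s.
Proof.
move=> L0 m0 mLn.
have n0 : (0 < n)%N by lia.
pose o := Ordinal n0.
have dep0 (v : 'I_n) : (v == o) = (depth L m v == 0%N) by rewrite depth_eq0.
apply: graph_of_metric.
- move=> x y; rewrite /spider; case: (eqVneq x y) => // xy.
  case: ifP => _; first lia.
  apply/negbTE; move: xy; apply: contra; rewrite addn_eq0 -!dep0.
  by move=> /andP[/eqP -> /eqP ->].
- move=> x y; rewrite /spider (eq_sym y) (eq_sym (leg _ _ y)) addnC.
  by rewrite (maxnC (depth L m x - _)%N).
- move=> x y z; rewrite /spider.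
  case: (eqVneq y z) => // yz; case: (eqVneq x z) => // xz.
  case: (eqVneq x y) => [->|xy]; first by move=> ->.
  case: (eqVneq (leg L s y) (leg L s z)) => [->|lyz].
    by case: (eqVneq (leg L s x) (leg L s z)) => lxz; lia.
  case: (eqVneq (leg L s x) (leg L s z)) => lxz;
  case: (eqVneq (leg L s x) (leg L s y)) => lxy; lia.
- move=> x z xz.
  have [Dxz|Dxz] := eqVneq (spider L s x z) 1%N.
    by exists x => //; rewrite Dxz /spider eqxx.
  have dx := depth_le L m x L0; have dz := depth_le L m z L0.
  have lx := leg_lt L m n s x L0 m0; have lz := leg_lt L m n s z L0 m0.
  (* The predecessor of [z] is sought at depth [d] of leg [i]; the last two premises keep it
     distinct from [x] and [z]. *)
  have via i d : (i < m)%N -> (0 < d <= L)%N ->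
      (forall y : 'I_n, x != y -> y != z -> leg L s y = i -> depth L m y = d ->
         spider L s y z = 1%N /\ spider L s x z = (spider L s x y).+1) ->
      ~ (leg L s x = i /\ depth L m x = d) -> ~ (leg L s z = i /\ depth L m z = d) ->
      exists2 y, spider L s y z = 1%N & spider L s x z = (spider L s x y).+1.
    move=> im dL Hy nx nz; have [y [_ ly dy]] := leg_vertex L m n s i d mLn im dL.
    have xy : x != y by apply/eqP => xy; apply: nx; rewrite xy.
    have yz : y != z by apply/eqP => yz; apply: nz; rewrite -yz.
    by have [] := Hy y xy yz ly dy; exists y.
  move: Dxz; rewrite {1}/spider (negbTE xz).
  case: (eqVneq (leg L s x) (leg L s z)) => lxz Dxz.
    have [dzx|dxz] := ltnP (depth L m z) (depth L m x).
      apply: (via (leg L s x) (depth L m z).+1); [by []|lia| |lia|lia].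
      move=> y xy yz ly dy; rewrite /spider (negbTE xz) (negbTE xy) (negbTE yz).
      by rewrite ly dy lxz eqxx; lia.
    apply: (via (leg L s x) (depth L m z).-1); [by []|lia| |lia|lia].
    move=> y xy yz ly dy; rewrite /spider (negbTE xz) (negbTE xy) (negbTE yz).
    by rewrite ly dy lxz eqxx; lia.
  have xz0 : ~ (depth L m x = 0%N /\ depth L m z = 0%N).
    move=> [/eqP + /eqP]; rewrite -!dep0 => /eqP xo /eqP zo.
    by move: xz; rewrite xo zo eqxx.
  have [dz0|dz0] := posnP (depth L m z).
    apply: (via (leg L s x) 1%N); [by []|lia| |lia|lia].
    move=> y xy yz ly dy; rewrite /spider (negbTE xz) (negbTE xy) (negbTE yz).
    by rewrite ly dy (negbTE lxz) eqxx; lia.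
  have [dz1|dz1] := eqVneq (depth L m z) 1%N; last first.
    apply: (via (leg L s z) (depth L m z).-1); [by []|lia| |by case=> /eqP; rewrite (negbTE lxz)|lia].
    move=> y xy yz ly dy; rewrite /spider (negbTE xz) (negbTE xy) (negbTE yz).
    by rewrite ly dy (negbTE lxz) eqxx; lia.
  (* Here [z] has depth 1 on another leg than [x], so its predecessor is the centre. *)
  have xo : x != o by rewrite dep0; lia.
  have oz : o != z by rewrite eq_sym dep0; lia.
  exists o; rewrite /spider.
    by rewrite (negbTE oz) /=; case: ifP => _; lia.
  rewrite (negbTE xz) (negbTE xo) /=.
  by rewrite (negbTE lxz); move: xo; rewrite dep0; case: ifP => _; lia.
Qed.

(** * Locating a single vertex *)

Fixpoint num_queries_at {R : realType} {n : nat} (u : 'I_n) (A : algorithm R n)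
    (delta : 'I_n -> 'I_n -> nat) : nat :=
  match A with
  | Output _ => 0%N
  | Query x y next =>
      (((x == u) || (y == u)) + num_queries_at u (next (delta x y)) delta)%N
  end.

Lemma sum_num_queries_at (R : realType) (n : nat) (U : {set 'I_n})
    (A : algorithm R n) (delta : 'I_n -> 'I_n -> nat) :
  (\sum_(u in U) num_queries_at u A delta <= 2 * num_queries A delta)%N.
Proof.
elim: A => [h|x y next IH] /=; first by rewrite big1.
rewrite big_split /= mulnS; apply: leq_add; last exact: IH.
have le1 (z : 'I_n) : (\sum_(u in U) (z == u) <= 1)%N.
  rewrite -big_mkcondr /= sum1dep_card -(cards1 z); apply: subset_leq_card.
  by apply/fintype.subsetP => u; rewrite !inE eq_sym => /andP[].
apply: leq_trans (leq_add (le1 x) (le1 y)); rewrite -big_split /=.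
by apply: leq_sum => u _; case: (x == u); case: (y == u).
Qed.

                                                                         
                                                                 
(** An elimination argument: [J] holds the candidates still consistent with the answers. A query at
    [u] gets a common answer from all candidates but at most one, so it removes at most one, and
    other queries remove none. The total cost is thus at least about [1 + 2 + ... + (#|J| - 1)]. *)
Lemma search_lower_bound (R : realType) (n : nat) (I : finType) (u : 'I_n)
    (delta : I -> 'I_n -> 'I_n -> nat) (A : algorithm R n) (J : {set I}) :
  (forall x y, ~~ ((x == u) || (y == u)) ->
     forall i j, delta i x y = delta j x y) ->
  (forall x y, exists v, exists k : option I, forall i, Some i != k -> delta i x y = v) ->
  {in J &, forall i j, i != j ->
     result A (delta i) <> result A (delta j)} ->
  (#|J| * #|J|.-1 <= 2 * \sum_(i in J) num_queries_at u A (delta i))%N.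
Proof.
move=> away near; elim: A J => [h|x y next IH] J /= sep.
  suff : (#|J| <= 1)%N by case: #|J| => [|[]].
  apply/card_le1_eqP => i j iJ jJ; have [//|ij] := eqVneq i j.
  by case: (sep i j iJ jJ ij).
rewrite big_split /= sum_nat_const.
have [J0|[i0 i0J]] := set_0Vmem J; first by rewrite J0 cards0.
case: (boolP ((x == u) || (y == u))) => [_|far].
  (* Every candidate of [J] pays for this query and [K] keeps all but at most one; the bound
     survives since [2a + (a-1)(a-2) >= a(a-1)]. *)
  have [v [k vk]] := near x y.
  pose K := [set i in J | Some i != k].
  have KJ : K \subset J by apply/fintype.subsetP => i; rewrite inE => /andP[].
  have cK : (#|J| <= #|K|.+1)%N.
    have cD : (#|J :\: K| <= 1)%N.
      apply/card_le1_eqP => i j; rewrite !inE => /andP[iK iJ] /andP[jK jJ].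
      by move: iK jK; rewrite iJ jJ /= !negbK => /eqP <- /eqP[].
    by move: (cardsID K J); rewrite (finset.setIidPr KJ); lia.
  have := IH v K.
  rewrite (eq_bigr (fun i => num_queries_at u (next (delta i x y)) (delta i)));
    last by move=> i; rewrite inE => /andP[_ /vk ->].
  have sumKJ : (\sum_(i in K) num_queries_at u (next (delta i x y)) (delta i)
      <= \sum_(i in J) num_queries_at u (next (delta i x y)) (delta i))%N.
    rewrite [leqRHS](big_setID K) /= (finset.setIidPr KJ); exact: leq_addr.
  have cKJ := subset_leq_card KJ.
  move=> IHK; have {}IHK : (#|K| * #|K|.-1 <= 2 * \sum_(i in K) num_queries_at u (next (delta i x y)) (delta i))%N.
    apply: IHK => i j iK jK ij.
    have := sep i j (fintype.subsetP KJ i iK) (fintype.subsetP KJ j jK) ij.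
    by move: iK jK; rewrite !inE => /andP[_ /vk ->] /andP[_ /vk ->].
  have J0 : (0 < #|J|)%N by apply/card_gt0P; exists i0.
  rewrite muln1; nia.
rewrite muln0 add0n.
have E i : delta i x y = delta i0 x y by exact: away.
under eq_bigr do rewrite E.
apply: IH => i j iJ jJ ij; have := sep i j iJ jJ ij; by rewrite !E.
Qed.

(** * Averaging over all placements *)

Definition update {I T : finType} (s : {ffun I -> T}) (u : I) (t : T) : {ffun I -> T} :=
  [ffun x => if x == u then t else s x].

(** Resampling one coordinate preserves the uniform distribution: exchanging the new value with the
    old one is an involution on pairs. *)
Lemma sum_update (I T : finType) (u : I) (F : {ffun I -> T} -> nat) :
  (\sum_s \sum_t F (update s u t) = #|T| * \sum_s F s)%N.
Proof.
pose h (p : {ffun I -> T} * T) := (update p.1 u p.2, p.1 u).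
have hK : involutive h.
  move=> [s t]; rewrite /h /= ffunE eqxx; congr pair.
  by apply/ffunP => x; rewrite !ffunE; case: eqP => // ->.
rewrite pair_big /= (reindex_inj (inv_inj hK)) /=.
rewrite (eq_bigr (fun p => F p.1)); last first.
  by move=> p _; have := hK p; rewrite {1}/h /= => /(congr1 fst) /= ->.
rewrite -(pair_big xpredT xpredT (fun s _ => F s)) /=.
under eq_bigr do rewrite sum_nat_const.
by rewrite -big_distrr /=.
Qed.

Lemma leg_update (L m n : nat) (s : {ffun 'I_n -> 'I_m}) (u v : 'I_n) (j : 'I_m) :
  (m * L < u)%N -> leg L (update s u j) v = if v == u then val j else leg L s v.
Proof.
move=> uU; rewrite /leg ffunE; case: (eqVneq v u) => [->|//].
by rewrite leqNgt uU.
Qed.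

Lemma spider_search (R : realType) (f : R) (L m n : nat) (A : algorithm R n)
    (s : {ffun 'I_n -> 'I_m}) (u : 'I_n) :
  (0 < L)%N -> (m * L < n)%N -> 0 <= f -> f < (2 * L)%:R -> (m * L < u)%N ->
  (forall j, approximates f (spider L (update s u j)) (result A (spider L (update s u j)))) ->
  (m * m.-1 <= 2 * \sum_j num_queries_at u A (spider L (update s u j)))%N.
Proof.
move=> L0 mLn f0 fL uU apx.
have du : depth L m u = L.
  by move: uU; rewrite /depth; case: (val u) => // w; rewrite ltnNge => /negbTE ->.
have lu j : leg L (update s u j) u = j by rewrite leg_update // eqxx.
have lx j x : x != u -> leg L (update s u j) x = leg L s x.
  by move=> /negbTE xu; rewrite leg_update // xu.
have := @search_lower_bound R n _ u (fun j => spider L (update s u j)) A [set: 'I_m]%SET.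
rewrite cardsT card_ord => lb; rewrite (eq_bigl (mem [set: 'I_m]%SET)); last first.
  by move=> j; rewrite /= inE.
apply: lb => [x y|x y|i j _ _ ij eq_res].
- by rewrite negb_or => /andP[xu yu] i j; rewrite /spider !lx.
- have [xy|xy] := eqVneq x y.
    by exists 0%N, None => i _; rewrite /spider xy eqxx.
  have key (w : 'I_n) : exists k : option 'I_m, forall i, Some i != k -> i != leg L s w :> nat.
    have [wm|wm] := ltnP (leg L s w) m.
      exists (Some (Ordinal wm)) => i; apply: contra => /eqP iw.
      by apply/eqP; congr Some; apply: val_inj.
    by exists None => i _; rewrite neq_ltn (leq_trans (ltn_ord i) wm).
  have [xu|xu] := eqVneq x u; have [yu|yu] := eqVneq y u.
  + by move: xy; rewrite xu yu eqxx.
  + have [k kP] := key y; exists (depth L m x + depth L m y)%N, k => i /kP ik.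
    by rewrite /spider (negbTE xy) xu lu lx // (negbTE ik).
  + have [k kP] := key x; exists (depth L m x + depth L m y)%N, k => i /kP ik.
    by rewrite /spider (negbTE xy) yu lu lx // eq_sym (negbTE ik).
  + exists (spider L s x y), None => i _.
    by rewrite /spider !lx.
(* Let [v] be the end of leg [i]. It is at distance 1 from [u] under placement [i] and [2 L] under
   placement [j], so a common estimate would force [2 L <= f]. *)
have dL : (0 < L <= L)%N by rewrite L0 leqnn.
have [v [vle lv dv]] := leg_vertex L m n s i L mLn (ltn_ord i) dL.
have uv : u != v by apply/eqP => uv; move: uU; rewrite uv ltnNge vle.
have vu : v != u by rewrite eq_sym.
have [h1 _] := apx i u v; have [_ h2] := apx j u v.
move: h1 h2; rewrite eq_res /spider (negbTE uv) !lu !lx // lv du dv eqxx.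
rewrite eq_sym (negbTE (ij : val i != val j)) subnn /= addnn -mul2n => h1.
have : f * result A (spider L (update s u j)) u v <= f * 1 by rewrite ler_wpM2l.
by move: fL; lra.
Qed.

(** The 4 combines the 2 of the elimination bound with the two endpoints of a query. *)
Lemma spider_average (R : realType) (f : R) (L m n : nat) (A : algorithm R n) :
  (0 < L)%N -> (0 < m)%N -> (m * L < n)%N -> 0 <= f -> f < (2 * L)%:R ->
  (forall s : {ffun 'I_n -> 'I_m}, approximates f (spider L s) (result A (spider L s))) ->
  (#|{ffun 'I_n -> 'I_m}| * ((n - (m * L).+1) * m.-1)
     <= 4 * \sum_(s : {ffun 'I_n -> 'I_m}) num_queries A (spider L s))%N.
Proof.
move=> L0 m0 mLn f0 fL apx.
pose U := [set u : 'I_n | (m * L < u)%N]%SET.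
have cU : #|U| = (n - (m * L).+1)%N.
  have := cardsC U; have -> : ~: U = [set u : 'I_n | (u < (m * L).+1)%N]%SET.
    by apply/setP => u; rewrite !inE -leqNgt ltnS.
  rewrite card_ord -(sum1dep_card (fun u : 'I_n => (u < (m * L).+1)%N)).
  by rewrite (big_ord_narrow mLn) /= sum1_card card_ord; lia.
have at_u u : u \in U -> (#|{ffun 'I_n -> 'I_m}| * m.-1
    <= 2 * \sum_(s : {ffun 'I_n -> 'I_m}) num_queries_at u A (spider L s))%N.
  rewrite inE => uU; rewrite -(leq_pmul2l m0) mulnCA [leqRHS]mulnCA.
  have := sum_update 'I_n 'I_m u (fun s => num_queries_at u A (spider L s)).
  rewrite card_ord => <-; rewrite -sum_nat_const big_distrr /=.
  by apply: leq_sum => s _; apply: (spider_search R f) => // j; exact: apx.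
rewrite -cU mulnCA -sum_nat_const (leq_trans (leq_sum _ at_u)) //.
rewrite -big_distrr /= exchange_big /= (_ : 4 = 2 * 2)%N // -mulnA leq_pmul2l //.
rewrite big_distrr /=; apply: leq_sum => s _; exact: sum_num_queries_at.
Qed.

(** * Choice of the parameters *)

Lemma hard_family (R : realType) (f : R) (n : nat) :
  (32 <= n)%N -> f <= n%:R / 32 ->
  exists (I : finType) (G : I -> connected_graph n), (0 < #|I|)%N /\
    forall A : algorithm R n,
      (forall i, approximates f (dist (G i)) (result A (dist (G i)))) ->
      (n%:R ^+ 2 / f / 128) *+ #|I| <= \sum_i (num_queries A (dist (G i)))%:R.
Proof.
move=> n32 fn.
pose L := (Num.truncn f).+1; pose m := (n %/ (2 * L))%N.
have fL : f < L%:R by rewrite /L truncnS_gt.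
have LfR : L%:R <= Num.max f 0 + 1.
  rewrite /L -natr1 lerD2r; have [f0|f0] := leP 0 f.
    by rewrite truncn_le.
  by have /truncn0Pn -> : ~~ (1 <= f) by lra.
have L0 : (0 < L)%N by [].
have nR : (32 : R) <= n%:R by rewrite (ler_nat R 32).
have Ln : (16 * L <= n)%N.
  rewrite -(ler_nat R) natrM; move: LfR; rewrite /Num.max; case: ltP; lra.
have nm : (2 * L * m <= n < 2 * L * m.+1)%N.
  by rewrite mulnC leq_divM mulnC ltn_ceil // muln_gt0.
have m0 : (0 < m)%N by nia.
have mLn : (m * L < n)%N by nia.
have [G distG] := choice (fun s : {ffun 'I_n -> 'I_m} => spider_graph L m n s L0 m0 mLn).
exists {ffun 'I_n -> 'I_m}, G; split.
  by apply/card_gt0P; exists [ffun=> Ordinal m0].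
move=> A apx.
(* For [f <= 0] the bound is nonpositive, as [0^-1 = 0]. *)
have [f0|f0] := leP f 0.
  apply: (@le_trans _ _ 0); last by apply: sumr_ge0 => i _; rewrite ler0n.
  rewrite mulrn_wle0 // pmulr_lle0 ?invr_gt0 ?ltr0n //.
  by rewrite mulr_ge0_le0 ?exprn_ge0 ?invr_le0.
                                                                                    
(* Correctness on a pair at distance [d >= 1] gives [h <= d <= f * h], which forces [f >= 1]. *)
have f1 : 1 <= f.
  have [n0 n1] : (0 < n)%N /\ (1 < n)%N by lia.
  have [] := apx [ffun=> Ordinal m0] (Ordinal n0) (Ordinal n1).
  have : 1 <= (dist (G [ffun=> Ordinal m0]) (Ordinal n0) (Ordinal n1))%:R :> R.
    rewrite ler1n distG /spider /=; case: ifP => _; first by rewrite leq_max.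
    by rewrite /depth /=; case: ifP.
  move: (result _ _ _ _) (_%:R : R) => h d d1 hd dfh.
  by nra.
have LfR' : L%:R <= 2 * f by move: LfR; rewrite max_l //; [lra|exact: ltW].
have f2L : f < (2 * L)%:R by rewrite natrM; lra.
have := spider_average R f L m n A L0 m0 mLn (ltW f0) f2L.
rewrite -(eq_bigr _ (fun s _ => congr1 (num_queries A) (distG s))).
set N := #|_|; set S := bigop.body _ _ _; set k := (n - _)%N.
have apxS : forall s : {ffun 'I_n -> 'I_m}, approximates f (spider L s) (result A (spider L s)).
  by move=> s; have := apx s; rewrite distG.
move=> /(_ apxS); rewrite -(ler_nat R) natrM [(4 * _)%:R]natrM [(k * _)%:R]natrM.
rewrite -natr_sum -/S -mulr_natl => Nkm.
(* The legs use at most half of the vertices. *)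
have k4 : n%:R <= 4 * k%:R :> R by rewrite -natrM ler_nat /k; nia.
(* From [n <= 2 L (m + 1) <= 4 f (m + 1)], with the excess [8 f] over [4 f (m - 1)] absorbed by
   [f <= n / 32]. *)
have y8 : n%:R / f <= 8 * m.-1%:R.
  rewrite ler_pdivrMr //.
  have : n%:R <= 2 * L%:R * (m.-1%:R + 2) :> R.
    by rewrite -natrD -!natrM ler_nat; nia.
  have : 2 * L%:R * (m.-1%:R + 2) <= 4 * f * (m.-1%:R + 2) :> R.
    by rewrite ler_wpM2r ?addr_ge0 //; lra.
  by lra.
have y0 : 0 <= n%:R / f by rewrite divr_ge0 // ltW.
have nn : n%:R / f * n%:R <= (8 * m.-1%:R) * (4 * k%:R) by exact: ler_pM.
have : N%:R * (n%:R / f * n%:R) <= N%:R * ((8 * m.-1%:R) * (4 * k%:R)) by exact: ler_wpM2l.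
rewrite expr2 -[_ * _ / f]mulrAC; lra.
Qed.

(** * From the average to a single bad input *)

Theorem theorem4 (R : realType) (f : nat -> R)
    (f_sublinear : f =o_\oo (fun n : nat => n%:R : R)) :
  exists2 c : R, 0 < c &
    \forall n \near \oo,
      (forall A : algorithm R n, computes_approximation (f n) A ->
         exists G : connected_graph n,
           c * (n%:R ^+ 2 / f n) <= (num_queries A (dist G))%:R)
      /\
      (forall (d : measure_display) (T : measurableType d)
              (P : probability T R) (A : randomized_algorithm n P),
         randomized_computes_approximation (f n) A ->
         exists G : connected_graph n,
           ((c * (n%:R ^+ 2 / f n))%:E <= expected_queries A G)%E).
Proof.
exists (128^-1); first by rewrite invr_gt0.
have f_small : \forall n \near \oo, f n <= n%:R / 32.
  move/eqoP : f_sublinear => /(_ 32^-1) []; first by rewrite invr_gt0.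
  move=> N _ fN; exists N => // n /fN /=.
  rewrite (ger0_norm (ler0n _ _)) mulrC; apply: le_trans; exact: ler_norm.
near=> n.
have n32 : (32 <= n)%N by near: n; exact: nbhs_infty_ge.
have [|I [G [I0 hard]]] := hard_family R (f n) n n32; first by near: n.
have hasI : has xpredT (index_enum I).
  by have /card_gt0P[i _] := I0; apply/hasP; exists i; rewrite ?mem_index_enum.
set b := _ * _.
have {}hard (A : algorithm R n) :
    (forall i, approximates (f n) (dist (G i)) (result A (dist (G i)))) ->
    b *+ #|I| <= \sum_i (num_queries A (dist (G i)))%:R.
  by rewrite /b mulrC; exact: hard.
split=> [A apx|d T P A apx].
  apply: contrapT => noG.
  have := hard A (fun i => apx (G i)).
  rewrite -sumr_const leNgt => /negP; apply; apply: ltr_sum => [|i _].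
    exact: hasI.
  by rewrite ltNge; apply/negP => bG; apply: noG; exists (G i).
have [b0|b0] := ltP b 0.
  have /card_gt0P[i _] := I0; exists (G i).
  apply: (@le_trans _ _ 0%E); first by rewrite lee_fin ltW.
  exact: expectation_ge0.
apply: contrapT => noG.
pose q i w : \bar R := (num_queries (A w) (dist (G i)))%:R%:E.
have q_mfun i : measurable_fun setT (q i).
  by apply/measurable_EFinP; exact: measurable_num_queries.
have : ((b *+ #|I|)%:E <= \sum_i expected_queries A (G i))%E.
  have -> : (\sum_i expected_queries A (G i) = \int[P]_w \sum_i q i w)%E.
    rewrite ge0_integral_sum // => [|i w _]; last by rewrite lee_fin.
    by apply: eq_bigr => i _; rewrite /expected_queries unlock.
  have -> : (b *+ #|I|)%:E = (\int[P]_(w in setT) (cst (b *+ #|I|)%:E) w)%E.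
    by rewrite integral_cst //= probability_setT mule1.
  apply: ae_ge0_le_integral => //.
  - by move=> w _; rewrite lee_fin mulrn_wge0.
  - by move=> w _; apply: sume_ge0 => i _; rewrite lee_fin.
  - exact: emeasurable_sum.
  (* The family is finite, so almost every seed yields a tree correct on all its members at once. *)
  - have := filter_forall (ae_filter_ringOfSetsType P) (fun i => apx (G i)).
    apply: filterS => w aw _; rewrite sumEFin lee_fin; exact: hard.
(* If no member is bad, every expectation is below [b], hence finite, and the sums can be compared
   in [R]. *)
have Efin i : expected_queries A (G i) = (fine (expected_queries A (G i)))%:E.
  rewrite fineK // ge0_fin_numE; last by exact: expectation_ge0.
  rewrite ltNge; apply/negP => /(le_trans (leey b%:E)) bG.
  by apply: noG; exists (G i).
rewrite (eq_bigr _ (fun i _ => Efin i)) sumEFin lee_fin leNgt => /negP; apply.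
rewrite -sumr_const; apply: ltr_sum => [|i _]; first exact: hasI.
by rewrite ltNge; apply/negP => bG; apply: noG; exists (G i); rewrite Efin lee_fin.
Unshelve. all: by end_near.
Qed.
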